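(* Let $\ell\ge0$ be an integer. If a two-digit refinable function $\varphi$ satisfies $\nu(\varphi)\ge\ell$, then its refinement equation possesses at least $\ell+2$ nonzero coefficients.
   Context: $M$ is an integer $n\times n$ matrix all of whose eigenvalues have modulus $>1$, with $|\det M|=2$ (the two-digit case). The refinement equation is $\varphi(x)=\sum_{k\in\mathbb Z^n}c_k\varphi(Mx-k)$ with real coefficients $c_k$, finitely many of them nonzero, and $\sum_kc_k=2$. The refinable function $\varphi$ is its unique compactly supported tempered distribution solution normalized by $\int\varphi=1$; it is assumed stable (its integer shifts are linearly independent, equivalently form a Riesz basis of their span). The mask is $c(\xi)=\frac12\sum_kc_ke^{-2\pi i(k,\xi)}$. Let $\{0,d^*\}$ be representatives of $\mathbb Z^n/M^T\mathbb Z^n$, and $M^{-T}=(M^T)^{-1}$. The accuracy $\nu(\varphi)$ is the maximal $\ell\ge0$ for which the following conditions, known to be equivalent for a stable two-digit refinable function, are satisfied: (1) the integer translates $\{\varphi(\cdot+k)\}_{k\in\mathbb Z^n}$ generate the space of algebraic polynomials of degree $\ell$ (i.e. at most $\ell$); (2) the equation satisfies the sum rules of order $\ell$, i.e. the mask $c$ has a zero of order at least $\ell+1$ at the point $\xi=M^{-T}d^*$; (3) $\varphi$ has rate of approximation at least $\ell+1$, i.e. the distance from an arbitrary $f\in C^{\ell+1}(\mathbb R^n)$ to the space generated by the functions $\{\varphi(N\cdot+k)\}_{k\in\mathbb Z^n}$ is $O(N^{-\ell-1})$. *)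

(* Defs.v *)
From HB Require Import structures.
From mathcomp Require Import all_boot all_order all_algebra.
From mathcomp Require Import finmap.
From mathcomp Require Import all_classical all_reals all_analysis.
From mathcomp.real_closed Require Import complex.
Set Implicit Arguments.
Unset Strict Implicit.
Unset Printing Implicit Defensive.
Import Order.TTheory GRing.Theory Num.Theory.
Import numFieldNormedType.Exports.
Local Open Scope classical_set_scope.
Local Open Scope ring_scope.

(* Points of R^n and Z^n are column vectors, so that the dilation is
   x |-> M *m x.  The norm `|x| on 'cV[R]_n is the library's sup norm. *)

Definition realmx (R : realType) (m n : nat) (A : 'M[int]_(m, n)) :
  'M[R]_(m, n) := map_mx intr A.

Definition dotv (R : realType) (n : nat) (x y : 'cV[R]_n) : R :=
  (x^T *m y) 0 0.

Section TemperedDistributions.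
Variables (R : realType) (n : nat).
Implicit Types (f : 'cV[R]_n -> R) (T : ('cV[R]_n -> R) -> R).

(* Iterated partial derivative in the coordinate directions listed by s. *)
Definition partials (s : seq 'I_n) f : 'cV[R]_n -> R :=
  foldr (fun i g => 'D_(delta_mx i 0) g) f s.

Definition smooth f : Prop :=
  forall (s : seq 'I_n) (x : 'cV[R]_n), differentiable (partials s f) x.

Definition schwartz f : Prop :=
  smooth f /\
  forall (m : nat) (s : seq 'I_n), exists C : R, forall x : 'cV[R]_n,
    `|x| ^+ m * `|partials s f x| <= C.

Definition schwartz_seminorm (N : nat) f : R :=
  sup [set r | exists (m : nat) (s : seq 'I_n) (x : 'cV[R]_n),
    [/\ (m <= N)%N, (size s <= N)%N & r = `|x| ^+ m * `|partials s f x|]].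

(* Smooth with compact support. *)
Definition test_function f : Prop :=
  smooth f /\ exists r : R, forall x : 'cV[R]_n, r < `|x| -> f x = 0.

(* A tempered distribution is a linear functional on the Schwartz space that
   is continuous, i.e. bounded by one of the (increasing) seminorms above.
   The functional is total; its values off the Schwartz space are never used.
   Real test functions and values suffice: the refinement coefficients are
   real, hence so is the normalized solution. *)
Definition tempered_distribution T : Prop :=
  [/\ forall (a : R) f g, schwartz f -> schwartz g ->
        T (fun x => a * f x + g x) = a * T f + T g
    & exists (N : nat) (C : R), forall f, schwartz f ->
        `|T f| <= C * schwartz_seminorm N f].

Definition compactly_supported T : Prop :=
  exists r : R, forall f, schwartz f ->
    (forall x : 'cV[R]_n, `|x| <= r -> f x = 0) -> T f = 0.

(* The integral of a compactly supported T is its value on any cutoff that is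
   equal to 1 on a large enough ball. *)
Definition has_integral T (v : R) : Prop :=
  exists r : R, forall f, schwartz f ->
    (forall x : 'cV[R]_n, `|x| <= r -> f x = 1) -> T f = v.

(* The distribution T(A . + b), for an invertible matrix A: dual to
   int T(A x + b) f(x) dx = |det A|^-1 int T(y) f(A^-1 (y - b)) dy. *)
Definition affine_comp T (A : 'M[R]_n) (b : 'cV[R]_n) :
  ('cV[R]_n -> R) -> R :=
  fun f => `|\det A|^-1 * T (fun y => f (invmx A *m (y - b))).

Definition integer_shift T (k : 'cV[int]_n) : ('cV[R]_n -> R) -> R :=
  affine_comp T 1%:M (realmx R k).

(* Linear independence of the integer shifts.  The coefficient sequences are
   the bounded ones: this is the form of independence that is equivalent to
   the Riesz basis property for a compactly supported function.  The sum over
   Z^n has finitely many nonzero terms when f is a test function. *)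
Definition stable T : Prop :=
  forall a : 'cV[int]_n -> R,
    (exists B : R, forall k, `|a k| <= B) ->
    (forall f, test_function f ->
       \sum_(k \in [set: 'cV[int]_n]) a k * integer_shift T k f = 0) ->
    forall k, a k = 0.

End TemperedDistributions.

Section Refinement.
Variables (R : realType) (n : nat).
Implicit Types (M : 'M[int]_n) (c : {fsfun 'cV[int]_n -> R with 0}).

Definition expanding M : Prop :=
  forall z : R[i], eigenvalue (map_mx intr M : 'M[R[i]]_n) z -> 1 < `|z|.

(* phi = sum_k c_k phi(M . - k), tested against Schwartz functions. *)
Definition refinement_equation M c (phi : ('cV[R]_n -> R) -> R) : Prop :=
  forall f, schwartz f ->
    phi f = \sum_(k <- finsupp c)
              c k * affine_comp phi (realmx R M) (- realmx R k) f.

Record two_digit_refinable M c (phi : ('cV[R]_n -> R) -> R) : Prop := {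
  refinable_expanding : expanding M;
  refinable_det : `|\det M| = 2;
  refinable_sum : \sum_(k <- finsupp c) c k = 2;
  refinable_tempered : tempered_distribution phi;
  refinable_support : compactly_supported phi;
  refinable_equation : refinement_equation M c phi;
  refinable_integral : has_integral phi 1;
  refinable_stable : stable phi }.

(* {0, d} is a set of representatives of Z^n / A Z^n. *)
Definition two_digits (A : 'M[int]_n) (d : 'cV[int]_n) : Prop :=
  (~ exists j : 'cV[int]_n, d = A *m j) /\
  forall k : 'cV[int]_n, exists j : 'cV[int]_n, k = A *m j \/ k = d + A *m j.

Definition expi (t : R) : R[i] := (cos t +i* sin t)%C.

Definition mask c (xi : 'cV[R]_n) : R[i] :=
  2^-1 * \sum_(k <- finsupp c)
           (c k)%:C%C * expi (- (2 * pi * dotv (realmx R k) xi)).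

(* All partial derivatives of order less than m vanish at x; meant for smooth
   g, such as the mask, which is a trigonometric polynomial. *)
Definition zero_of_order_at_least (m : nat) (g : 'cV[R]_n -> R[i])
    (x : 'cV[R]_n) : Prop :=
  forall s : seq 'I_n, (size s < m)%N ->
    partials s (fun y => complex.Re (g y)) x = 0 /\
    partials s (fun y => complex.Im (g y)) x = 0.

Definition sum_rules M c (d : 'cV[int]_n) (l : nat) : Prop :=
  zero_of_order_at_least l.+1 (mask c) (invmx (realmx R M)^T *m realmx R d).

(* The accuracy of the refinable function: the largest l for which the sum
   rules of order l hold (-oo if there is none).  For a stable two-digit phi
   these are equivalent to the integer shifts of phi generating the polynomials
   of degree at most l, and to phi having approximation rate at least l + 1. *)
Definition accuracy M c (d : 'cV[int]_n) : \bar R :=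
  ereal_sup [set (l%:R)%:E | l in [set l : nat | sum_rules M c d l]].

End Refinement.

(* Main.v *)
Require Import Defs.
From mathcomp Require Import all_boot all_order all_algebra.
From mathcomp Require Import finmap.
From mathcomp Require Import all_classical all_reals all_analysis.
From mathcomp.real_closed Require Import complex.
From mathcomp Require Import ring.
Set Implicit Arguments.
Unset Strict Implicit.
Unset Printing Implicit Defensive.
Import Order.TTheory GRing.Theory Num.Theory.
Import numFieldNormedType.Exports.
Local Open Scope ring_scope.

(* Differentiating the mask at x = M^-T d, the sum rules of order l say that
   sum_k b_k q(k) = 0 for every polynomial q of degree at most l, where
   b_k = c_k exp(-2 pi i (k, x)) is nonzero exactly when c_k is.  With at most
   l + 1 nonzero coefficients, a product of at most l affine functions vanishes
   at every node but a chosen one, k0, which forces c_k0 = 0; but some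
   coefficient is nonzero, since their sum is 2. *)

(** Both derivatives are limits of the same difference quotient; this brings in the one-variable
    chain rule. *)
Lemma is_derive_along_line (R : numFieldType) (V W : normedModType R)
    (f : V -> W) (x v : V) (df : W) :
  is_derive (0 : R) 1 (fun h : R => f (h *: v + x)) df -> is_derive x v f df.
Proof.
have E : (fun h : R => h^-1 *: (((fun h : R => f (h *: v + x)) \o shift 0)
            (h *: (1 : R)) - f (0 *: v + x))) =
         (fun h => h^-1 *: ((f \o shift x) (h *: v) - f x)).
  by apply/funext => h /=; rewrite addr0 scale0r add0r [h *: 1]mulr1.
by case=> D <-; split; [move: D|]; rewrite /derivable /derive E.
Qed.

Lemma dotvDr (R : realType) (n : nat) (w x y : 'cV[R]_n) :
  dotv w (x + y) = dotv w x + dotv w y.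
Proof. by rewrite /dotv mulmxDr mxE. Qed.

Lemma dotvZr (R : realType) (n : nat) (w : 'cV[R]_n) (a : R) (x : 'cV[R]_n) :
  dotv w (a *: x) = a * dotv w x.
Proof. by rewrite /dotv -scalemxAr mxE. Qed.

Lemma dotv_delta (R : realType) (n : nat) (w : 'cV[R]_n) (i : 'I_n) :
  dotv w (delta_mx i 0) = w i 0.
Proof. by rewrite /dotv -colE !mxE. Qed.

(** Writing [- sin] as a cosine advanced by [pi / 2] keeps the shape closed under differentiation,
    so it can be iterated. *)
Lemma is_derive_cos_dotv (R : realType) (n : nat) (w : 'cV[R]_n) (t : R)
    (x v : 'cV[R]_n) :
  is_derive x v (fun y => cos (dotv w y + t))
    (dotv w v * cos (dotv w x + t + pi / 2)).
Proof.
apply: is_derive_along_line.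
have -> : (fun h : R => cos (dotv w (h *: v + x) + t)) =
    cos \o (dotv w v \*: id + cst (dotv w x + t)).
  by apply/funext => h /=; rewrite dotvDr dotvZr -addrA mulrC.
set g := (dotv w v \*: id + _ : R -> R).
have g0 : g 0 = dotv w x + t.
  by rewrite /g fctE /= /GRing.scale_fun /= scaler0 add0r.
have -> : dotv w v * cos (dotv w x + t + pi / 2) =
    - sin (g 0) * (dotv w v *: 1 + 0).
  by rewrite g0 cosDpihalf addr0 [_ *: 1]mulr1 mulrC.
exact: is_derive1_comp.
Qed.

Lemma derive_trig_sum (R : realType) (n : nat) (I : Type) (r : seq I)
    (a : I -> R) (w : I -> 'cV[R]_n) (t : R) (x v : 'cV[R]_n) :
  'D_v (fun y => \sum_(k <- r) a k * cos (dotv (w k) y + t)) x =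
  \sum_(k <- r) a k * dotv (w k) v * cos (dotv (w k) x + (t + pi / 2)).
Proof.
apply: derive_val; elim: r => [|k r IH].
  rewrite big_nil; under eq_fun do rewrite big_nil; exact: is_derive_cst.
rewrite big_cons; under eq_fun do rewrite big_cons.
apply: is_deriveD => //; rewrite -mulrA addrA.
exact/is_deriveZ/is_derive_cos_dotv.
Qed.

(* The exponents [s] of the monomial are listed with repetitions, as the
   directions of [partials] are. *)
Definition monom (R : realType) (n : nat) (s : seq 'I_n) (w : 'cV[R]_n) : R :=
  \prod_(i <- s) w i 0.

Lemma partials_trig_sum (R : realType) (n : nat) (I : Type) (r : seq I)
    (a : I -> R) (w : I -> 'cV[R]_n) (t : R) (s : seq 'I_n) :
  partials s (fun y => \sum_(k <- r) a k * cos (dotv (w k) y + t)) =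
  fun y => \sum_(k <- r) a k * monom s (w k) *
                         cos (dotv (w k) y + (t + (size s)%:R * (pi / 2))).
Proof.
elim: s => [|i s IH] /=.
  by apply/funext => y; apply: eq_bigr => k _;
     rewrite /monom big_nil mulr1 mul0r addr0.
rewrite IH; apply/funext => y; rewrite derive_trig_sum.
apply: eq_bigr => k _; rewrite dotv_delta /monom big_cons.
by congr (_ * cos _); [ring | rewrite -natr1; ring].
Qed.

(** Since the exponent is negative, the imaginary part carries [- sin], which is the cosine a
    quarter turn ahead. The [+ 0] matches the form of [partials_trig_sum]. *)
Lemma maskE (R : realType) (n : nat) (c : {fsfun 'cV[int]_n -> R with 0})
    (y : 'cV[R]_n) :
  Defs.mask c y =
  ((\sum_(k <- finsupp c) c k / 2 *
      cos (dotv ((2 * pi) *: Defs.realmx R k) y + 0)) +i*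
   (\sum_(k <- finsupp c) c k / 2 *
      cos (dotv ((2 * pi) *: Defs.realmx R k) y + pi / 2)))%C.
Proof.
rewrite /Defs.mask mulr_sumr; elim: (enum_fset _) => [|k r IH].
  by rewrite !big_nil.
rewrite !big_cons {}IH.
have -> : (2^-1 : R[i]) = (2^-1 : R)%:C%C.
  by rewrite fmorphV rmorph_nat.
have -> : dotv ((2 * pi) *: Defs.realmx R k) y = 2 * pi * dotv (Defs.realmx R k) y.
  by rewrite /dotv linearZ /= -scalemxAl mxE.
apply/eqP; rewrite eq_complex /= /expi cosN sinN cosDpihalf addr0.
apply/andP; split; apply/eqP => /=; ring.
Qed.

(* Shifting the phase by a quarter turn exchanges cosine and sine, so the two
   hypotheses give every phase. *)
Lemma trig_sum_all_phases (R : realType) (I : Type) (r : seq I)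
    (a u : I -> R) (t t' : R) :
  \sum_(k <- r) a k * cos (u k + t) = 0 ->
  \sum_(k <- r) a k * cos (u k + (t + pi / 2)) = 0 ->
  \sum_(k <- r) a k * cos (u k + t') = 0.
Proof.
move=> H1 H2.
have -> : \sum_(k <- r) a k * cos (u k + t') =
    cos (t' - t) * (\sum_(k <- r) a k * cos (u k + t)) +
    sin (t' - t) * (\sum_(k <- r) a k * cos (u k + (t + pi / 2))).
  rewrite !mulr_sumr -big_split; apply: eq_bigr => k _ /=.
  rewrite addrA cosDpihalf.
  have -> : u k + t' = (t' - t) + (u k + t) by ring.
  by rewrite cosD; ring.
by rewrite H1 H2 !mulr0 addr0.
Qed.

Lemma vanishing_moments_prod (R : realType) (n : nat) (I : Type) (r : seq I)
    (b : I -> R) (w : I -> 'cV[R]_n) (m : nat) :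
  (forall s : seq 'I_n, (size s < m)%N ->
     \sum_(k <- r) b k * monom s (w k) = 0) ->
  forall p : seq ('I_n * R), (size p < m)%N ->
    \sum_(k <- r) b k * \prod_(q <- p) (w k q.1 0 - q.2) = 0.
Proof.
move=> H p pm.
(* Generalized for induction on [p]: expanding a factor moves its coordinate into the monomial,
   keeping the total degree, and its constant out of the sum, lowering it. *)
suff S s : (size p + size s < m)%N ->
    \sum_(k <- r) b k * monom s (w k) * \prod_(q <- p) (w k q.1 0 - q.2) = 0.
  rewrite -[RHS](S [::]) ?addn0//; apply: eq_bigr => k _.
  by rewrite /monom big_nil mulr1.
elim: p {pm} s => [|[i a] p IH] s sm.
  by rewrite -[RHS](H s)//; apply: eq_bigr => k _; rewrite big_nil mulr1.
have /IH H1 : (size p + size (i :: s) < m)%N by rewrite /= addnS.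
have /IH H2 : (size p + size s < m)%N by rewrite (leq_trans _ sm)// ltnS leqnSn.
transitivity (\sum_(k <- r) b k * monom (i :: s) (w k) *
      \prod_(q <- p) (w k q.1 0 - q.2) -
    a * \sum_(k <- r) b k * monom s (w k) *
      \prod_(q <- p) (w k q.1 0 - q.2)); last by rewrite H1 H2 mulr0 subr0.
rewrite mulr_sumr -sumrB; apply: eq_bigr => k _.
by rewrite big_cons /monom big_cons /=; ring.
Qed.

Lemma vanishing_moments_size (R : realType) (n : nat) (I : eqType) (r : seq I)
    (b : I -> R) (w : I -> 'cV[R]_n) (m : nat) (k0 : I) :
  injective w -> uniq r -> k0 \in r -> b k0 != 0 ->
  (forall s : seq 'I_n, (size s < m)%N ->
     \sum_(k <- r) b k * monom s (w k) = 0) ->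
  (m < size r)%N.
Proof.
move=> w_inj r_uniq k0r bk0 H; rewrite ltnNge; apply/negP => rm.
have sep k : k != k0 -> exists i : 'I_n, w k0 i 0 != w k i 0.
  move=> kk0; apply/existsP; rewrite -negb_forall; apply: contra kk0.
  move=> /forallP wE; apply/eqP/w_inj/matrixP => i j.
  by rewrite ord1 (eqP (wE i)).
(* One factor per other node [k], in a coordinate where [w k] and [w k0] differ. *)
have [p [psz pk0 pk]] : exists p : seq ('I_n * R), [/\ size p = size (rem k0 r),
    \prod_(q <- p) (w k0 q.1 0 - q.2) != 0 &
    forall k, k \in rem k0 r -> \prod_(q <- p) (w k q.1 0 - q.2) = 0].
  have : k0 \notin rem k0 r by rewrite mem_rem_uniq// inE eqxx.
  elim: (rem k0 r) => [|k s IH].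
    by exists [::]; split=> //; rewrite big_nil oner_eq0.
  rewrite inE negb_or eq_sym => /andP[/sep[i wi] /IH[p [psz pk0 pk]]].
  exists ((i, w k i 0) :: p); split; rewrite ?big_cons /= ?psz//.
    by rewrite mulf_neq0// subr_eq0.
  move=> k'; rewrite inE big_cons /= => /predU1P[->|/pk->].
    by rewrite subrr mul0r.
  by rewrite mulr0.
have pm : (size p < m)%N.
  by rewrite psz size_rem// prednK ?(leq_trans _ rm)//; case: (r) k0r.
have := vanishing_moments_prod H pm.
rewrite (perm_big _ (perm_to_rem k0r)) /= big_cons [X in _ + X]big1_seq ?addr0.
  by move/eqP; rewrite mulf_eq0 (negPf bk0) (negPf pk0).
by move=> k /= /pk ->; rewrite mulr0.
Qed.

(** Real weights replace the complex ones: a single phase suffices, as only the weight at [k0] must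
    be shown nonzero. *)
Lemma sum_rules_finsupp (R : realType) (n : nat) (M : 'M[int]_n)
    (c : {fsfun 'cV[int]_n -> R with 0}) (d : 'cV[int]_n) (l : nat) :
  sum_rules M c d l -> finsupp c != fset0 -> (l.+1 < #|` finsupp c|)%N.
Proof.
rewrite /sum_rules; set x := (invmx _ *m _) => Hc /fset0Pn[k0 k0c].
set w := fun k : 'cV[int]_n => (2 * pi) *: Defs.realmx R k.
have pi2 : 2 * pi != 0 :> R by rewrite mulf_neq0 ?pnatr_eq0// gt_eqF ?pi_gt0.
have w_inj : injective w.
  move=> j k /(scalerI pi2)/matrixP jk; apply/matrixP => i i'.
  by have := jk i i'; rewrite !mxE => /intr_inj.
(* The phase is chosen so that the cosine is 1 at [k0]. *)
pose b k := c k / 2 * cos (dotv (w k) x - dotv (w k0) x).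
have Re_mask : (fun y => complex.Re (Defs.mask c y)) = fun y =>
    \sum_(k <- finsupp c) c k / 2 * cos (dotv (w k) y + 0).
  by apply/funext => y; rewrite maskE.
have Im_mask : (fun y => complex.Im (Defs.mask c y)) = fun y =>
    \sum_(k <- finsupp c) c k / 2 * cos (dotv (w k) y + pi / 2).
  by apply/funext => y; rewrite maskE.
apply: (@vanishing_moments_size _ _ _ _ b w _ k0) => //.
- by rewrite /b subrr cos0 mulr1 mulf_neq0 ?invr_eq0 ?pnatr_eq0// -mem_finsupp.
(* After the derivatives [s], the two parts still differ by a quarter turn, as [trig_sum_all_phases]
   requires. *)
- move=> s /Hc[]; rewrite Re_mask Im_mask !partials_trig_sum add0r [pi / 2 + _]addrC.
  move=> Re0 Im0; rewrite -[RHS](trig_sum_all_phases (- dotv (w k0) x) Re0 Im0).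
  by apply: eq_bigr => k _; rewrite /b mulrAC.
Qed.

Theorem theorem8p1 (R : realType) (n : nat) (M : 'M[int]_n)
    (c : {fsfun 'cV[int]_n -> R with 0}) (phi : ('cV[R]_n -> R) -> R)
    (d : 'cV[int]_n) (l : nat)
    (hphi : two_digit_refinable M c phi)
    (hd : two_digits M^T d)
    (hnu : ((l%:R)%:E <= accuracy M c d)%E) :
  (l + 2 <= #|` finsupp c|)%N.
Proof.
(* A supremum need not be attained, but some admissible [l'] exceeds [l - 1], and integrality gives
   [l <= l']. *)
have /ereal_sup_gt[_ [l' Hl' <-]] : ((l%:R - 1)%:E < accuracy M c d)%E.
  by apply: lt_le_trans hnu; rewrite lte_fin ltrBlDr ltrDl.
rewrite lte_fin ltrBlDr natr1 ltr_nat ltnS => ll'.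
have c0 : finsupp c != fset0.
  apply/eqP => c0; have := refinable_sum hphi.
  by rewrite c0 big_nil => /eqP; rewrite eq_sym pnatr_eq0.
by rewrite addn2 (leq_trans _ (sum_rules_finsupp Hl' c0))// !ltnS.
Qed.
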